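(* Let $A$ be an integral $n\times q$ matrix with column vectors $v_1,\ldots,v_q\in\mathbb{Z}^n$ and let $w=(w_1,\ldots,w_q)\in\mathbb{Z}^q$ be an integral vector. If the polyhedron $P=\{x\in\mathbb{R}^n\mid xA\le w\}$ is integral and $\mathcal{H}(A,w)=\{(v_1,w_1),\ldots,(v_q,w_q)\}\subset\mathbb{Z}^{n+1}$ is a Hilbert basis, then the system $xA\le w$ is totally dual integral.
   Context: A rational polyhedron is integral if it is the convex hull of the integral points it contains. A finite set $\mathcal{H}\subset\mathbb{Z}^m$ is a Hilbert basis if $\mathbb{N}\mathcal{H}=\mathbb{R}_+\mathcal{H}\cap\mathbb{Z}^m$, where $\mathbb{N}\mathcal{H}$ and $\mathbb{R}_+\mathcal{H}$ are the non-negative integer span and non-negative real span of $\mathcal{H}$. The system $xA\le w$ is totally dual integral (TDI) if the minimum in the LP-duality equation $$\max\{\langle a,x\rangle\mid xA\le w\}=\min\{\langle y,w\rangle\mid y\ge0;\ Ay=a\}$$ has an integral optimum solution $y$ for each integral vector $a\in\mathbb{Z}^n$ for which the minimum is finite. *)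

(* Defs.v *)
From mathcomp Require Import all_boot all_order all_algebra finmap.
From mathcomp Require Import classical_sets reals convex.

Set Implicit Arguments.
Unset Strict Implicit.
Unset Printing Implicit Defensive.

Import Order.TTheory GRing.Theory Num.Theory.
Local Open Scope classical_set_scope.
Local Open Scope ring_scope.

Definition int_to_real_mx (R : realType) (m n : nat) (M : 'M[int]_(m, n)) :
  'M[R]_(m, n) := map_mx (fun z : int => z%:~R) M.

(* Points x are row vectors and multipliers y are column vectors, so that
   x *m A and A *m y are the products xA and Ay. *)

Definition polyhedron (R : realType) (n q : nat)
    (A : 'M[R]_(n, q)) (w : 'rV[R]_q) : set 'rV[R]_n :=
  [set x : 'rV[R]_n | forall j, (x *m A) 0 j <= w 0 j].

Definition convex_hull (R : realType) (n : nat) (S : set 'rV[R]_n) :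
  set 'rV[R]_n := smallest (@convex_set R 'rV[R]_n) S.

Definition integral_polyhedron (R : realType) (n : nat) (P : set 'rV[R]_n) :
  Prop :=
  P = convex_hull (P `&` range (@int_to_real_mx R 1 n)).

Definition nat_span (m : nat) (H : {fset 'cV[int]_m}) : set 'cV[int]_m :=
  [set z | exists c : 'cV[int]_m -> nat, z = \sum_(h <- H) h *+ c h].

Definition real_cone (R : realType) (m : nat) (H : {fset 'cV[int]_m}) :
    set 'cV[R]_m :=
  [set z | exists2 c : 'cV[int]_m -> R, (forall h, 0 <= c h) &
           z = \sum_(h <- H) c h *: int_to_real_mx R h].

Definition Hilbert_basis (R : realType) (m : nat) (H : {fset 'cV[int]_m}) :
  Prop :=
  nat_span H = [set z | real_cone H (int_to_real_mx R z)].

Definition extended_columns (n q : nat) (A : 'M[int]_(n, q)) (w : 'rV[int]_q) :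
  {fset 'cV[int]_(n + 1)} :=
  [fset col_mx (col j A) (col j w) | j : 'I_q]%fset.

(* The dual program is min {<y, w> | y >= 0, Ay = a}. *)
Definition dual_feasible (R : realType) (n q : nat)
    (A : 'M[R]_(n, q)) (a : 'cV[R]_n) : set 'cV[R]_q :=
  [set y : 'cV[R]_q | (forall j, 0 <= y j 0) /\ A *m y = a].

Definition dual_objective (R : realType) (q : nat)
    (w : 'rV[R]_q) (y : 'cV[R]_q) : R := (w *m y) 0 0.

Definition dual_optimal (R : realType) (n q : nat)
    (A : 'M[R]_(n, q)) (w : 'rV[R]_q) (a : 'cV[R]_n) (y : 'cV[R]_q) : Prop :=
  dual_feasible A a y /\
  forall y', dual_feasible A a y' -> dual_objective w y <= dual_objective w y'.

(* has_inf: the program is feasible and its objective is bounded below, which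
   for a linear program is also equivalent to the minimum being attained. *)
Definition dual_finite (R : realType) (n q : nat)
    (A : 'M[R]_(n, q)) (w : 'rV[R]_q) (a : 'cV[R]_n) : Prop :=
  has_inf (dual_objective w @` dual_feasible A a).

Definition totally_dual_integral (R : realType) (n q : nat)
    (A : 'M[R]_(n, q)) (w : 'rV[R]_q) : Prop :=
  forall a : 'cV[int]_n, dual_finite A w (int_to_real_mx R a) ->
    exists y : 'cV[int]_q,
      dual_optimal A w (int_to_real_mx R a) (int_to_real_mx R y).

(* Main.v *)
Require Import Defs.
From mathcomp Require Import all_boot all_order all_algebra finmap.
From mathcomp Require Import classical_sets reals convex.
From mathcomp Require Import boolp interval_inference lra.

(** Fix an integral [a] for which the dual program is feasible and bounded
    below, and let [m] be its infimum.  If every integral point [p] of [P]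
    satisfied [p a < m], it would satisfy [p a <= ceil m - 1], because [p a] is
    an integer; since [P] is the convex hull of its integral points, this
    inequality would hold on all of [P], and strong duality (in the form
    [affine_farkas]) would give a dual solution of value at most
    [ceil m - 1 < m].  So some integral [p] in [P] has [p a >= m].  By weak
    duality [x a <= m <= p a] on [P], and a second use of [affine_farkas]
    produces a dual solution [y] of value at most [p a], which is therefore
    optimal ([integral_dual_minimum]).

    Thus the minimum is the integer [p a], and [y] writes the integral vector
    [(a, p a)] as a non-negative real combination of the columns [(v_j, w_j)].
    The Hilbert basis property turns this into a non-negative integral
    combination, whose coefficients are a dual solution of the same value, that
    is, an integral optimum.

    Applying strong duality with a bound on [P], rather than with an optimal
    primal point, avoids having to show that the primal maximum is attained, and
    covers the case of an empty [P]: there any bound holds, which contradicts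
    the boundedness of the dual. *)

Set Implicit Arguments.
Unset Strict Implicit.
Unset Printing Implicit Defensive.

Import Order.TTheory GRing.Theory Num.Theory.
Local Open Scope classical_set_scope.
Local Open Scope ring_scope.

(** Farkas' lemma, by induction on the number of columns.  Split off the first
    column [u], leaving [B].  If the inequalities given by [B] alone already
    imply the one given by [b], the coefficient of [u] can be [0].  Otherwise
    some [x0] violates this implication, so [x0 u < 0], and [x0] can be scaled
    to [x0 u = -1].  Then [x |-> x + (x u) x0] projects onto the hyperplane
    [x u = 0], along [x0]; composing the functionals in [B] and [b] with this
    projection gives the instance of the lemma to which induction applies. *)
Lemma farkas (R : realFieldType) (n q : nat) (A : 'M[R]_(n, q)) (b : 'cV[R]_n) :
  (forall x : 'rV[R]_n, (forall j, 0 <= (x *m A) 0 j) -> 0 <= (x *m b) 0 0) ->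
  exists y : 'cV[R]_q, (forall j, 0 <= y j 0) /\ A *m y = b.
Proof.
elim: q A b => [|q IHq] A b Ab.
  exists 0; split=> [[]//|]; rewrite mulmx0; apply/esym/matrixP => i j.
  have xb0 (x : 'rV_n) : (x *m b) 0 0 = 0.
    apply/eqP; rewrite eq_le Ab ?andbT => [|[]//].
    have /Ab : forall j : 'I_0, 0 <= (- x *m A) 0 j by case.
    by rewrite mulNmx [X in 0 <= X]mxE oppr_ge0.
  by have := xb0 (delta_mx 0 i); rewrite -rowE !mxE (ord1 j).
rewrite -[q.+1]/(1 + q)%N in A Ab *.
rewrite -[A]hsubmxK; set u := lsubmx A; set B := rsubmx A.
have {}Ab (x : 'rV_n) : 0 <= (x *m u) 0 0 ->
    (forall j, 0 <= (x *m B) 0 j) -> 0 <= (x *m b) 0 0.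
  move=> xu xB; apply: Ab => j; rewrite -[A]hsubmxK mul_mx_row.
  by case: (split_ordP j) => k ->; rewrite ?row_mxEl ?row_mxEr// (ord1 k).
have [Bb|] := EM (forall x : 'rV[R]_n,
    (forall j, 0 <= (x *m B) 0 j) -> 0 <= (x *m b) 0 0).
  have [y [y0 <-]] := IHq B b Bb; exists (col_mx 0 y); split=> [j|].
    by case: (split_ordP j) => k ->; rewrite ?col_mxEu ?col_mxEd// mxE.
  by rewrite mul_row_col mulmx0 add0r.
move=> /existsNP[x1 /not_implyP[x1B /negP]]; rewrite -ltNge => x1b.
have x1u : (x1 *m u) 0 0 < 0.
  by rewrite ltNge; apply/negP => /Ab/(_ x1B); rewrite leNgt x1b.
pose x0 := (- (x1 *m u) 0 0)^-1 *: x1.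
have c0 : 0 < (- (x1 *m u) 0 0)^-1 by rewrite invr_gt0 oppr_gt0.
have x0B j : 0 <= (x0 *m B) 0 j by rewrite -scalemxAl mxE mulr_ge0// ltW.
have x0b : (x0 *m b) 0 0 < 0 by rewrite -scalemxAl mxE pmulr_rlt0.
have x0u : x0 *m u = (-1)%:M.
  rewrite [LHS]mx11_scalar -scalemxAl mxE; congr (_%:M).
  by rewrite invrN mulNr mulVf ?lt_eqF.
(* [C + u x0 C] is the composite of [C] with the projection along [x0]. *)
have [x xB|y [y0 yE]] := IHq (B + u *m (x0 *m B)) (b + u *m (x0 *m b)).
  have E p (C : 'M_(n, p)) :
      x *m (C + u *m (x0 *m C)) = (x + x *m u *m x0) *m C.
    by rewrite mulmxDr mulmxDl !mulmxA.
  rewrite E; apply: Ab => [|j]; last by rewrite -E.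
  by rewrite mulmxDl -mulmxA x0u mul_mx_scalar scaleN1r subrr mxE.
(* Solving [B y + u x0 B y = b + u x0 b] for [b] gives the coefficient of [u];
   it is non-negative since [x0 B >= 0 > x0 b]. *)
exists (col_mx (x0 *m B *m y - x0 *m b) y); split=> [j|].
  case: (split_ordP j) => k ->; rewrite ?col_mxEu ?col_mxEd//.
  rewrite (ord1 k) mxE [X in _ + X]mxE subr_ge0 (le_trans (ltW x0b))//.
  by rewrite mxE sumr_ge0// => i _; rewrite mulr_ge0.
rewrite mul_row_col mulmxBr; move: yE; rewrite mulmxDl !mulmxA => yE.
by rewrite addrAC [X in X - _]addrC yE addrK.
Qed.

Lemma weak_duality (R : realType) (n q : nat) (A : 'M[R]_(n, q)) (w : 'rV[R]_q)
    (a : 'cV[R]_n) (x : 'rV[R]_n) (y : 'cV[R]_q) :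
  polyhedron A w x -> dual_feasible A a y ->
  (x *m a) 0 0 <= dual_objective w y.
Proof.
move=> xP [y0 <-]; rewrite mulmxA /dual_objective !mxE.
by apply: ler_sum => j _; apply: ler_wpM2r.
Qed.

(** Strong duality in inhomogeneous form.  It is Farkas' lemma for the system
    [A y = a, w y + s = k] with a slack variable [s >= 0].  A certificate of
    infeasibility is a pair [(x, s)] with [s >= 0], [x A + s w >= 0] and
    [x a + s k < 0].  If [s > 0], then [- x / s] is a point of the polyhedron
    violating the bound [k]; if [s = 0], then [x] contradicts the feasibility
    of the dual. *)
Lemma affine_farkas (R : realType) (n q : nat) (A : 'M[R]_(n, q))
    (w : 'rV[R]_q) (a : 'cV[R]_n) (k : R) :
  dual_feasible A a !=set0 ->
  (forall x, polyhedron A w x -> (x *m a) 0 0 <= k) ->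
  exists2 y, dual_feasible A a y & dual_objective w y <= k.
Proof.
move=> [y1 [y10 y1E]] Pk.
have [z|y [y0]] := @farkas R (n + 1) (q + 1)
    (block_mx A 0 w 1%:M) (col_mx a k%:M).
  rewrite -[z]hsubmxK; set x := lsubmx z; set t := rsubmx z.
  rewrite [t]mx11_scalar; set s := t 0 0 => zE.
  rewrite mul_row_block mulmx0 add0r mulmx1 mul_scalar_mx in zE.
  have s0 : 0 <= s by have := zE (rshift q 0); rewrite row_mxEr mxE mulr1n.
  have xA j : 0 <= (x *m A) 0 j + s * w 0 j.
    by have := zE (lshift 1 j); rewrite row_mxEl mxE [X in _ + X]mxE.
  rewrite mul_row_col -scalar_mxM mxE [X in _ + X]mxE mulr1n.
  move: s0; rewrite le_eqVlt => /predU1P[s0|s0].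
    rewrite -s0 mul0r addr0 -y1E mulmxA mxE sumr_ge0// => j _.
    by rewrite mulr_ge0//; have := xA j; rewrite -s0 mul0r addr0.
  have /Pk : polyhedron A w (- s^-1 *: x).
    move=> j; rewrite -scalemxAl mxE mulNr lerNl ler_pdivlMl// mulrN.
    by rewrite -subr_ge0 opprK.
  rewrite -scalemxAl mxE mulNr lerNl ler_pdivlMl// mulrN.
  by rewrite -subr_ge0 opprK.
rewrite -[y]vsubmxK mul_block_col mul0mx addr0 mul1mx => /eq_col_mx[Ay wy].
exists (usubmx y); first by split=> // j; rewrite mxE.
move/matrixP/(_ 0 0): wy; rewrite mxE [RHS]mxE mulr1n => <-.
by rewrite lerDl mxE.
Qed.

(** The convexity that lets a linear inequality pass from the integral points of
    an integral polyhedron to the whole polyhedron. *)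
Lemma convex_halfspace (R : realType) (n : nat) (a : 'cV[R]_n) (k : R) :
  @convex_set R 'rV[R]_n [set x : 'rV[R]_n | (x *m a) 0 0 <= k].
Proof.
move=> x y t; rewrite !inE /= => xk yk.
have -> : ((conv t x y : 'rV[R]_n) *m a) 0 0 =
   t%:num * (x *m a) 0 0 + (1 - t%:num) * (y *m a) 0 0.
  by rewrite [in LHS]mulmxDl -!scalemxAl mxE [X in X + _]mxE [X in _ + X]mxE.
have t0 : 0 <= t%:num by []. have t1 : t%:num <= 1 by [].
nra.
Qed.

Lemma le_integral_polyhedron (R : realType) (n : nat) (P : set 'rV[R]_n)
    (a : 'cV[R]_n) (k : R) : integral_polyhedron P ->
  (forall p : 'rV[int]_n, P (int_to_real_mx R p) ->
     (int_to_real_mx R p *m a) 0 0 <= k) ->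
  forall x, P x -> (x *m a) 0 0 <= k.
Proof.
move=> Pint Pk x; rewrite Pint; move: x.
apply: (smallest_sub (convex_halfspace (a := a) (k := k))) => p [Pp [z _ zp]].
by rewrite /= -zp; apply: Pk; rewrite zp.
Qed.

Lemma int_to_real_mul (R : realType) (m n p : nat) (M : 'M[int]_(m, n))
    (N : 'M[int]_(n, p)) :
  int_to_real_mx R (M *m N) = int_to_real_mx R M *m int_to_real_mx R N.
Proof. exact: map_mxM. Qed.

(** Equal columns of [E] are a single element of the finite set, so its
    coefficient is the sum of the multipliers of all the columns equal to it. *)
Lemma real_cone_columns (R : realType) (m q : nat) (E : 'M[int]_(m, q))
    (y : 'cV[R]_q) : (forall j, 0 <= y j 0) ->
  real_cone [fset col j E | j : 'I_q]%fset (int_to_real_mx R E *m y).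
Proof.
move=> y0; exists (fun h => \sum_(j | col j E == h) y j 0).
  by move=> h; apply: sumr_ge0.
under eq_bigr do rewrite scaler_suml.
rewrite (exchange_big_dep predT)//=; apply/colP => i.
rewrite mxE summxE; apply: eq_bigr => j _.
have jE : col j E \in [fset col j E | j : 'I_q]%fset by apply/imfsetP; exists j.
under eq_bigl do rewrite eq_sym.
by rewrite -big_filter filter_pred1_uniq ?fset_uniq// big_seq1 !mxE mulrC.
Qed.

(** The coefficient of an element of the finite set of columns is given to one
    of the indices at which this column occurs; the others receive [0]. *)
Lemma nat_span_columns (m q : nat) (E : 'M[int]_(m, q)) (z : 'cV[int]_m) :
  nat_span [fset col j E | j : 'I_q]%fset z ->
  exists y : 'cV[int]_q, (forall j, 0 <= y j 0) /\ E *m y = z.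
Proof.
move=> [c ->].
pose e (h : 'cV[int]_m) : 'cV[int]_q :=
  if [pick j | col j E == h] is Some j then delta_mx j 0 else 0.
exists (\sum_(h <- [fset col j E | j : 'I_q]%fset) e h *+ c h); split=> [j|].
  rewrite summxE; apply: sumr_ge0 => h _; rewrite mulmxnE mulrn_wge0// /e.
  by case: pickP => [i _|_]; rewrite mxE.
rewrite mulmx_sumr; apply: eq_big_seq => h /imfsetP[j _ hE].
rewrite (raddfMn (mulmx E)) /e /=; case: pickP => [i /eqP <-|/(_ j)]; last by rewrite hE eqxx.
by rewrite colE.
Qed.

Lemma int_to_real_pairing (R : realType) (n : nat) (p : 'rV[int]_n)
    (a : 'cV[int]_n) :
  (int_to_real_mx R p *m int_to_real_mx R a) 0 0 = ((p *m a) 0 0)%:~R.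
Proof. by rewrite -int_to_real_mul mxE. Qed.

(** By weak duality the inequality in the conclusion is an equality, and [y] is
    an optimum of the dual: the dual minimum is attained, and it equals the
    value of [a] at an integral point of the polyhedron. *)
Lemma integral_dual_minimum (R : realType) (n q : nat) (A : 'M[R]_(n, q))
    (w : 'rV[R]_q) (a : 'cV[int]_n) :
  integral_polyhedron (polyhedron A w) ->
  dual_finite A w (int_to_real_mx R a) ->
  exists2 p : 'rV[int]_n, polyhedron A w (int_to_real_mx R p) &
  exists2 y, dual_feasible A (int_to_real_mx R a) y &
    dual_objective w y <= ((p *m a) 0 0)%:~R.
Proof.
move=> Pint [D0 Dlb]; set aR := int_to_real_mx R a in D0 Dlb *.
set D := _ @` _ in D0 Dlb; have [_ [y0 y0F _]] := D0.
have feas : dual_feasible A aR !=set0 by exists y0.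
have [p pP pa] : exists2 p : 'rV[int]_n, polyhedron A w (int_to_real_mx R p) &
    inf D <= ((p *m a) 0 0)%:~R.
  apply: contrapT => noP.
  have Pk : forall x, polyhedron A w x ->
      (x *m aR) 0 0 <= (Num.ceil (inf D) - 1)%:~R.
    apply: le_integral_polyhedron => // p pP.
    rewrite int_to_real_pairing ler_int lerBrDr lezD1 ceil_gt_int ltNge.
    by apply/negP => pa; apply: noP; exists p.
  have [y yF] := affine_farkas feas Pk.
  rewrite leNgt (lt_le_trans (ceilB1_lt _))//.
  by apply: ge_inf => //; exists y.
exists p => //; apply: affine_farkas => // x xP; apply: le_trans pa.
by apply: lb_le_inf => // _ [y yF <-]; apply: weak_duality xP yF.
Qed.

Theorem theorem4p1 (R : realType) (n q : nat)
    (A : 'M[int]_(n, q)) (w : 'rV[int]_q) :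
  integral_polyhedron
    (polyhedron (int_to_real_mx R A) (int_to_real_mx R w)) ->
  Hilbert_basis R (extended_columns A w) ->
  totally_dual_integral (int_to_real_mx R A) (int_to_real_mx R w).
Proof.
move=> Pint HB a afin.
have [p pP [y yF yp]] := integral_dual_minimum Pint afin.
have pD y' : dual_feasible (int_to_real_mx R A) (int_to_real_mx R a) y' ->
    ((p *m a) 0 0)%:~R <= dual_objective (int_to_real_mx R w) y'.
  by rewrite -int_to_real_pairing; apply: weak_duality.
have {}yp : dual_objective (int_to_real_mx R w) y = ((p *m a) 0 0)%:~R.
  by apply: le_anti; rewrite yp pD.
have HE : extended_columns A w = [fset col j (col_mx A w) | j : 'I_q]%fset.
  by apply: eq_imfset => // j; rewrite /= col_col_mx.
have : nat_span (extended_columns A w) (col_mx a (p *m a)).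
  rewrite HB /= HE.
  have -> : int_to_real_mx R (col_mx a (p *m a)) =
      int_to_real_mx R (col_mx A w) *m y.
    rewrite /int_to_real_mx !map_col_mx mul_col_mx yF.2; congr col_mx.
    by rewrite [RHS]mx11_scalar [LHS]mx11_scalar mxE -yp.
  by apply: real_cone_columns; case: yF.
rewrite HE => /nat_span_columns[z [z0]]; rewrite mul_col_mx => /eq_col_mx[Az wz].
exists z; split.
  split=> [j|]; first by rewrite mxE ler0z.
  by rewrite -int_to_real_mul Az.
move=> y' /pD; congr (_ <= _).
by rewrite /dual_objective -int_to_real_mul wz [RHS]mxE.
Qed.
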